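(* Let $A=\mathrm{diag}(\lambda_1,\lambda_2)\in\mathbb{C}^{2\times 2}$ with $|\lambda_1|\ge|\lambda_2|$, let $C\in\mathbb{C}^{m\times 2}$ be such that $(C,A)$ is detectable, and let $Q,\Sigma_0\in\mathbb{C}^{2\times2}$, $R\in\mathbb{C}^{m\times m}$ be Hermitian and strictly positive definite. Let $p_c=f_c(A,C)$ be the critical value of the Kalman filter with intermittent observations for this system. (a) If one of the following conditions holds: (1) $|\lambda_1|>|\lambda_2|$; (2) $\mathrm{rank}(C)=2$; then $$p_c=\max\bigl(1-|\lambda_1|^{-2},\,0\bigr).$$ (b) Otherwise, $$p_c=\max\Bigl(1-|\lambda_1|^{-\frac{2}{1-D_M(\varphi/2\pi)}},\,0\Bigr),$$ where $\varphi\in[0,2\pi)$ is defined by $\lambda_1=\lambda_2\exp(j\varphi)$ with $j^2=-1$, and $D_M$ is the modified Dirichlet function: $D_M(x)=0$ for $x$ irrational, and $D_M(x)=1/q$ for $x=r/q$ with $r,q\in\mathbb{Z}$, $q>0$, irreducible.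
   Context: Kalman filter with intermittent observations: consider $x_{k+1}=Ax_k+w_k$, $y_k=Cx_k+v_k$, with mutually independent Gaussian $w_k$ (mean $0$, covariance $Q$), $v_k$ (mean $0$, covariance $R$) and $x_0$ (mean $\bar x_0$, covariance $\Sigma_0$); the measurement $y_k$ is received iff $\gamma_k=1$, where $(\gamma_k)_{k\ge 0}$ are i.i.d. Bernoulli with $P(\gamma_k=1)=p\in[0,1]$, independent of everything else. The one-step prediction error covariance $P_k$ is the random matrix defined by $P_0=\Sigma_0$ and $$P_{k+1}=AP_kA^H+Q-\gamma_k AP_kC^H(CP_kC^H+R)^{-1}CP_kA^H .$$ (For real matrices $^H$ is the transpose; complex matrices are allowed because a real system is brought to diagonal form over $\mathbb{C}$.) Matrix inequalities are in the positive semidefinite order. $E P_k$ is called bounded if there is a matrix $M$ with $E P_k\le M$ for all $k$, and unbounded otherwise. The critical value of the system is $p_c=\inf\{p\in[0,1]: E P_k \text{ is bounded}\}$; it depends only on $(A,C)$ when $Q,R,\Sigma_0>0$, and is denoted $f_c(A,C)$. Convention: when $|\lambda_1|<1$ both formulas are read as $p_c=0$ (this covers the cases $\lambda_1=0$ and $\varphi=0$, in which the displayed expressions are not literally defined). *)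

(* Defs.v *)
From HB Require Import structures.
From mathcomp Require Export all_boot all_order all_algebra.
From mathcomp Require Export all_classical all_reals all_analysis.
From mathcomp Require Export complex.

Set Implicit Arguments.
Unset Strict Implicit.
Unset Printing Implicit Defensive.

Export Order.TTheory GRing.Theory Num.Theory.
Export numFieldNormedType.Exports.

Local Open Scope classical_set_scope.
Local Open Scope ring_scope.
Local Open Scope complex_scope.
Local Open Scope sesquilinear_scope.

Section ComplexNumbers.
Variable R : realType.

(* The modulus as an element of R (`|z| lives in R[i]). *)
Definition cmod (z : R[i]) : R := complex.Re `|z|.

Definition expj (phi : R) : R[i] := cos phi +i* sin phi.

End ComplexNumbers.

Section Matrices.
Variable R : realType.

Definition posdef n (M : 'M[R[i]]_n) : Prop :=
  M \is hermsymmx /\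
  forall x : 'cV[R[i]]_n, x != 0 -> 0 < (x^t* *m M *m x) 0 0.

Definition possemidef n (M : 'M[R[i]]_n) : Prop :=
  M \is hermsymmx /\
  forall x : 'cV[R[i]]_n, 0 <= (x^t* *m M *m x) 0 0.

Definition loewner_le n (M N : 'M[R[i]]_n) : Prop := possemidef (N - M).

Definition schur_stable n (F : 'M[R[i]]_n) : Prop :=
  forall a : R[i], eigenvalue F a -> cmod a < 1.

Definition detectable n m (C : 'M[R[i]]_(m, n)) (A : 'M[R[i]]_n) : Prop :=
  exists L : 'M[R[i]]_(n, m), schur_stable (A - L *m C).

End Matrices.

Section Probability.
Context d (T : measurableType d) (R : realType) (P : probability T R).

Definition mutually_independent d' (E : measurableType d')
    (X : nat -> {RV P >-> E}) : Prop :=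
  forall (s : seq nat) (B : nat -> set E),
    uniq s -> (forall k, measurable (B k)) ->
    P (\bigcap_(k in [set` s]) (X k @^-1` B k)) =
    (\prod_(k <- s) P (X k @^-1` B k))%E.

Definition iid_bernoulli (p : R) (gamma : nat -> {RV P >-> bool}) : Prop :=
  (forall k, P [set w | gamma k w = true] = p%:E) /\
  mutually_independent gamma.

(* Entrywise expectation; [fine] only discards the extended-real wrapper when
   the entries are integrable, as is the case for finitely-valued ones. *)
Definition mxexpectation m n (X : T -> 'M[R[i]]_(m, n)) : 'M[R[i]]_(m, n) :=
  \matrix_(i, j) (fine 'E_P[fun w => complex.Re (X w i j)] +i*
                  fine 'E_P[fun w => complex.Im (X w i j)]).

End Probability.

Section IntermittentKalman.
Context (R : realType) (n m : nat).
Variables (A : 'M[R[i]]_n) (C : 'M[R[i]]_(m, n)).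
Variables (Q : 'M[R[i]]_n) (V : 'M[R[i]]_m) (Sigma0 : 'M[R[i]]_n).

(* The prediction error covariance along one arrival sequence [g]; [V] is the
   measurement noise covariance.  [C X C^H + V] is invertible for V > 0. *)
Fixpoint error_cov (g : nat -> bool) (k : nat) : 'M[R[i]]_n :=
  if k is k'.+1 then
    let X := error_cov g k' in
    A *m X *m A^t* + Q
    - (g k')%:R *: (A *m X *m C^t* *m invmx (C *m X *m C^t* + V)
                    *m C *m X *m A^t*)
  else Sigma0.

Definition mean_cov d (T : measurableType d) (P : probability T R)
    (gamma : nat -> {RV P >-> bool}) (k : nat) : 'M[R[i]]_n :=
  mxexpectation P (fun w => error_cov (fun j => gamma j w) k).

Definition mean_cov_bounded d (T : measurableType d) (P : probability T R)
    (gamma : nat -> {RV P >-> bool}) : Prop :=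
  exists M : 'M[R[i]]_n, forall k, loewner_le (mean_cov gamma k) M.

(* For each p, [gamma p] is the arrival process of rate p, living on its own
   probability space; the infimum is taken in \bar R so that it would be +oo
   on an empty set. *)
Definition critical_value (d : R -> measure_display)
    (T : forall p, measurableType (d p)) (P : forall p, probability (T p) R)
    (gamma : forall p, nat -> {RV (P p) >-> bool}) : \bar R :=
  ereal_inf [set p%:E | p in
    [set p : R | 0 <= p <= 1 /\ mean_cov_bounded (gamma p)]].

End IntermittentKalman.

(* The modified Dirichlet function. *)
Definition DM (R : realType) (x : R) : R :=
  match pselect (exists q : rat, x = ratr q) with
  | left x_rat => ((denq (sval (cid x_rat)))%:~R)^-1
  | right _ => 0
  end.

(* Main.v *)
Require Import Defs.
From mathcomp Require Import measurable_realfun ring lra zify.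

(* Upper bounds on P_k come from suboptimal gains: for every gain K the Riccati
   step is dominated by (A - KC) X (A - KC)^* + Q + K V K^*.  If C sees both
   modes, two arrivals at lag u with lambda1^u <> lambda2^u allow a deadbeat
   choice of gains, after which P_k is bounded whatever its previous value.  If
   lambda1^u = lambda2^u only for q | u, a window of q n steps without such a
   pair has all its arrivals in one residue class modulo q, which happens with
   probability at most q (1-p)^((q-1) n); there one uses the open-loop growth
   |lambda1|^(2 q n).  So the mean contracts over a long window as soon as
   |lambda1|^(2q) (1-p)^(q-1) < 1.  In the absence of resonance q is arbitrary
   and the condition becomes |lambda1|^2 (1-p) < 1.
   Conversely, when rank C = 1 and lambda1^q = lambda2^q, a vector of ker C is
   never seen at times divisible by q, so P_k grows in open loop on the event,
   of probability (1-p)^((q-1) n), that there is no arrival at the other times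
   before q n; without resonance one uses the event that nothing arrives. *)

Set Implicit Arguments.
Unset Strict Implicit.
Unset Printing Implicit Defensive.

Local Open Scope classical_set_scope.
Local Open Scope ring_scope.
Local Open Scope complex_scope.

(** * Semidefinite matrices *)

Local Open Scope sesquilinear_scope.

Section ConjugateTranspose.
Variable K : numClosedFieldType.

Lemma ctmxM m n p (A : 'M[K]_(m, n)) (B : 'M[K]_(n, p)) :
  (A *m B)^t* = B^t* *m A^t*.
Proof. by rewrite trmx_mul map_mxM. Qed.

Lemma ctmxD m n (A B : 'M[K]_(m, n)) : (A + B)^t* = A^t* + B^t*.
Proof. by rewrite linearD map_mxD. Qed.

Lemma ctmxN m n (A : 'M[K]_(m, n)) : (- A)^t* = - A^t*.
Proof. by rewrite linearN map_mxN. Qed.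

Lemma ctmxB m n (A B : 'M[K]_(m, n)) : (A - B)^t* = A^t* - B^t*.
Proof. by rewrite ctmxD ctmxN. Qed.

Lemma ctmxZ m n a (A : 'M[K]_(m, n)) : (a *: A)^t* = Num.conj a *: A^t*.
Proof. by rewrite linearZ map_mxZ. Qed.

Lemma ctmx1 n : (1%:M : 'M[K]_n)^t* = 1%:M.
Proof. by rewrite tr_scalar_mx map_scalar_mx /= conjC1. Qed.

Lemma hermsymmxP n (M : 'M[K]_n) : M \is hermsymmx <-> M^t* = M.
Proof.
by split=> [/is_hermitianmxP|] h; [|apply/is_hermitianmxP];
  rewrite ?expr0 ?scale1r in h *.
Qed.

End ConjugateTranspose.

Section SemiDefinite.
Variable R : realType.

Lemma possemidef_herm n (M : 'M[R[i]]_n) : possemidef M -> M^t* = M.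
Proof. by case=> /hermsymmxP. Qed.

Lemma posdef_semi n (M : 'M[R[i]]_n) : posdef M -> possemidef M.
Proof.
move=> [hM pM]; split=> // x.
by have [->|/pM/ltW//] := eqVneq x 0; rewrite mulmx0 mxE.
Qed.

Lemma possemidef0 n : possemidef (0 : 'M[R[i]]_n).
Proof.
split=> [|x]; last by rewrite mulmx0 mul0mx mxE.
by apply/hermsymmxP; rewrite trmx0 map_mx0.
Qed.

Lemma possemidefD n (M N : 'M[R[i]]_n) :
  possemidef M -> possemidef N -> possemidef (M + N).
Proof.
move=> [/hermsymmxP hM pM] [/hermsymmxP hN pN]; split=> [|x].
  by apply/hermsymmxP; rewrite ctmxD hM hN.
by rewrite mulmxDr mulmxDl mxE addr_ge0.
Qed.

Lemma possemidefZ n (a : R[i]) (M : 'M[R[i]]_n) :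
  0 <= a -> possemidef M -> possemidef (a *: M).
Proof.
move=> a0 [/hermsymmxP hM pM]; split=> [|x].
  by apply/hermsymmxP; rewrite ctmxZ hM conj_Creal // ger0_real.
by rewrite -scalemxAr -scalemxAl mxE mulr_ge0.
Qed.

Lemma possemidef_congr m n (F : 'M[R[i]]_(m, n)) (M : 'M[R[i]]_n) :
  possemidef M -> possemidef (F *m M *m F^t*).
Proof.
move=> [/hermsymmxP hM pM]; split=> [|x].
  by apply/hermsymmxP; rewrite !ctmxM trmxCK hM mulmxA.
by have := pM (F^t* *m x); rewrite ctmxM trmxCK !mulmxA.
Qed.

Lemma possemidef_diag n (M : 'M[R[i]]_n) i : possemidef M -> 0 <= M i i.
Proof.
move=> [_ /(_ (delta_mx i 0))].
by rewrite trmx_delta map_delta_mx -rowE -colE !mxE.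
Qed.

Lemma possemidef_scalar n (a : R[i]) : 0 <= a -> possemidef (a%:M : 'M[R[i]]_n).
Proof.
move=> a0; rewrite -scalemx1; apply: possemidefZ => //.
split=> [|x]; first by apply/hermsymmxP; rewrite ctmx1.
rewrite mulmx1 mxE sumr_ge0 // => i _.
by rewrite !mxE mulrC mul_conjC_ge0.
Qed.

(** A nonzero [x] with [M x = 0] would satisfy [x^* M x = 0]. *)
Lemma posdef_unitmx n (M : 'M[R[i]]_n) : posdef M -> M \in unitmx.
Proof.
move=> [_ pM]; rewrite -unitmx_tr -row_free_unit -kermx_eq0.
apply/eqP/row_matrixP => i; rewrite row0; apply/eqP/contraT => xn0.
have := pM (row i (kermx M^T))^T; rewrite trmx_eq0 => /(_ xn0).
have e : M *m (row i (kermx M^T))^T = 0.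
  by apply: trmx_inj; rewrite trmx_mul trmxK trmx0 -row_mul mulmx_ker row0.
by rewrite -mulmxA e mulmx0 mxE ltxx.
Qed.

Lemma posdefD n (M N : 'M[R[i]]_n) :
  possemidef M -> posdef N -> posdef (M + N).
Proof.
move=> pM pN; split=> [|x xn0].
  by have [] := possemidefD pM (posdef_semi pN).
rewrite mulmxDr mulmxDl mxE; apply: ltr_wpDl; first by case: pM.
by case: pN => _; apply.
Qed.

(* With [v = M^-1 x] and [s = v^* M v], the congruence of [M] by
   [1 - s^-1 v v^* M] is [M - s^-1 x x^*]. *)
Lemma posdef_ge_rank1 n (M : 'M[R[i]]_n) (x : 'cV[R[i]]_n) :
  posdef M -> exists2 c : R, 0 < c & possemidef (M - c%:C *: (x *m x^t*)).
Proof.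
move=> pM; have [->|xn0] := eqVneq x 0.
  exists 1 => //; rewrite mul0mx scaler0 subr0; exact: posdef_semi.
have uM := posdef_unitmx pM; have hM := possemidef_herm (posdef_semi pM).
have [v Mv] : exists v, M *m v = x by exists (invmx M *m x); rewrite mulKVmx.
have vn0 : v != 0 by apply: contraNneq xn0 => v0; rewrite -Mv v0 mulmx0.
have s0 := (proj2 pM) v vn0; set s := (_ *m _) 0 0 in s0.
have sE : v^t* *m M *m v = s%:M by rewrite [LHS]mx11_scalar.
have sR : s = (complex.Re s)%:C by rewrite RRe_real // gtr0_real.
exists (complex.Re s)^-1; first by rewrite invr_gt0 -ltcR -sR.
have -> : ((complex.Re s)^-1)%:C = s^-1 by rewrite [in RHS]sR fmorphV.
pose E := 1%:M - s^-1 *: (v *m v^t* *m M).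
have vM : v^t* *m M = x^t* by rewrite -Mv ctmxM hM.
have sc : Num.conj s^-1 = s^-1 by rewrite conj_Creal // rpredV gtr0_real.
suff -> : M - s^-1 *: (x *m x^t*) = E^t* *m M *m (E^t*)^t*.
  by apply: possemidef_congr; exact: posdef_semi.
have EE : M *m E = M - s^-1 *: (x *m x^t*).
  by rewrite mulmxBr mulmx1 -scalemxAr !mulmxA Mv -mulmxA vM.
rewrite trmxCK -mulmxA EE /E -mulmxA vM ctmxB ctmx1 ctmxZ sc ctmxM trmxCK.
rewrite mulmxBl mul1mx mulmxBr -!scalemxAl -scalemxAr scalerA.
have -> : x *m v^t* *m M = x *m x^t* by rewrite -mulmxA vM.
have -> : x *m v^t* *m (x *m x^t*) = s *: (x *m x^t*).
  have vx : v^t* *m x = s%:M by rewrite -Mv mulmxA.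
  by rewrite mulmxA -[x *m v^t* *m x]mulmxA vx mul_mx_scalar -scalemxAl.
by rewrite scalerA -mulrA mulVf ?gt_eqF // mulr1 subrr subr0.
Qed.

(** A vector orthogonal to [x]; the quadratic form of [M] there equals that of the adjugate of [M]
    at [x]. *)
Definition adjvec (x : 'cV[R[i]]_2) : 'cV[R[i]]_2 :=
  \col_i if i == 0 then Num.conj (x 1 0) else - Num.conj (x 0 0).

(* [tr(M) - M] is the adjugate of the 2 x 2 matrix [M]. *)
Lemma possemidef_le_trace (M : 'M[R[i]]_2) :
  possemidef M -> possemidef ((\tr M)%:M - M).
Proof.
move=> pM; have [hM qM] := pM; split=> [|x].
  apply/hermsymmxP; rewrite ctmxB (possemidef_herm pM).
  rewrite tr_scalar_mx map_scalar_mx /= conj_Creal // ger0_real //.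
  by rewrite sumr_ge0 // => i _; exact: possemidef_diag.
suff -> : (x^t* *m ((\tr M)%:M - M) *m x) 0 0
          = ((adjvec x)^t* *m M *m adjvec x) 0 0 by [].
rewrite /mxtrace !mxE !big_ord_recl !big_ord0 !mxE /=.
rewrite !big_ord_recl !big_ord0 !mxE /= !rmorphN /= !conjCK.
have -> : lift 0 0 = 1 :> 'I_2 by apply: val_inj.
by rewrite /= !mulr1n !mulr0n; ring.
Qed.

End SemiDefinite.

(** * The Riccati step *)

Section Riccati.
Context (R : realType) (n m : nat).
Variables (A : 'M[R[i]]_n) (C : 'M[R[i]]_(m, n)).
Variables (Q : 'M[R[i]]_n) (V : 'M[R[i]]_m).
Implicit Types (X : 'M[R[i]]_n) (s : seq bool).

Definition riccati X (b : bool) : 'M[R[i]]_n :=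
  A *m X *m A^t* + Q
  - b%:R *: (A *m X *m C^t* *m invmx (C *m X *m C^t* + V) *m C *m X *m A^t*).

Definition riccati_run X s : 'M[R[i]]_n := foldl riccati X s.

Lemma riccati_run_rcons X s b :
  riccati_run X (rcons s b) = riccati (riccati_run X s) b.
Proof. exact: foldl_rcons. Qed.

Lemma riccati_run_cat X s1 s2 :
  riccati_run X (s1 ++ s2) = riccati_run (riccati_run X s1) s2.
Proof. exact: foldl_cat. Qed.

Lemma error_covE Sigma0 g k :
  error_cov A C Q V Sigma0 g k = riccati_run Sigma0 (mkseq g k).
Proof.
by elim: k => [//|k IHk]; rewrite mkseqS riccati_run_rcons -IHk.
Qed.

(** The error covariance produced by an arbitrary linear gain [K] (Joseph form); the optimal gain
    gives the Riccati step. *)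
Definition joseph (K : 'M[R[i]]_(n, m)) X : 'M[R[i]]_n :=
  (A - K *m C) *m X *m (A - K *m C)^t* + Q + K *m V *m K^t*.

Lemma riccati_false X : riccati X false = A *m X *m A^t* + Q.
Proof. by rewrite /riccati scale0r subr0. Qed.

Hypotheses (pQ : posdef Q) (pV : posdef V).

Lemma posdef_innovation X : possemidef X -> posdef (C *m X *m C^t* + V).
Proof. by move=> pX; apply: posdefD => //; apply: possemidef_congr. Qed.

(* Completing the square: the optimal gain [G] satisfies [G S = A X C^*]. *)
Lemma joseph_square X : possemidef X ->
  exists G, exists2 S, possemidef S & forall K,
    joseph K X = riccati X true + (K - G) *m S *m (K - G)^t*.
Proof.
move=> pX; have pS := posdef_innovation pX; have uS := posdef_unitmx pS.
set S := _ + V in pS uS; have hS := possemidef_herm (posdef_semi pS).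
have hX := possemidef_herm pX.
have SE : C *m X *m C^t* + V = S by [].
have [G GE] : exists G, A *m X *m C^t* *m invmx S = G by eexists.
exists G; exists S; first exact: posdef_semi.
have GS : G *m S = A *m X *m C^t* by rewrite -GE mulmxKV.
have SG : S *m G^t* = C *m X *m A^t*.
  by rewrite -[in LHS]hS -ctmxM GS !ctmxM trmxCK hX mulmxA.
move=> K; rewrite /riccati /joseph SE GE scale1r.
have -> : G *m C *m X *m A^t* = G *m S *m G^t* by rewrite -!mulmxA SG !mulmxA.
rewrite !(ctmxB, ctmxM) !(mulmxBl, mulmxBr) GS.
have -> : K *m C *m X *m (C^t* *m K^t*) = K *m S *m K^t* - K *m V *m K^t*.
  by rewrite -mulmxBl -mulmxBr -SE addrK !mulmxA.
have -> : K *m S *m G^t* = K *m C *m X *m A^t*.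
  by rewrite -mulmxA SG !mulmxA.
rewrite !mulmxA.
move: (A *m X *m A^t*) (K *m C *m X *m A^t*) (A *m X *m C^t* *m K^t*)
  (A *m X *m C^t* *m G^t*) (K *m S *m K^t*) (K *m V *m K^t*) => a b c d e f.
by apply/matrixP => i j; rewrite !mxE; ring.
Qed.

Lemma riccati_true_le K X : possemidef X ->
  possemidef (joseph K X - riccati X true).
Proof.
move=> /joseph_square[G [S pS ->]]; rewrite addrC addKr.
exact: possemidef_congr.
Qed.

(** This writes the step as a sum of congruences, where semidefiniteness and lower bounds become
    visible. *)
Lemma riccati_true_gain X : possemidef X -> exists G, riccati X true = joseph G X.
Proof.
by move=> /joseph_square[G [S _ e]]; exists G; rewrite e subrr !mul0mx addr0.
Qed.

Lemma riccati_openloop_le b X : possemidef X ->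
  possemidef (A *m X *m A^t* + Q - riccati X b).
Proof.
case: b => pX; last by rewrite riccati_false subrr; exact: possemidef0.
(* The zero gain ignores the measurement. *)
have := riccati_true_le 0 pX.
by rewrite /joseph !mul0mx subr0 addr0.
Qed.

Lemma riccati_semidef b X : possemidef X -> possemidef (riccati X b).
Proof.
have pQ' := posdef_semi pQ; have pV' := posdef_semi pV.
case: b => pX; last first.
  rewrite riccati_false; exact: (possemidefD (possemidef_congr _ pX) pQ').
have [G ->] := riccati_true_gain pX.
exact: (possemidefD (possemidefD (possemidef_congr _ pX) pQ')
                    (possemidef_congr _ pV')).
Qed.

Lemma riccati_run_semidef s X : possemidef X -> possemidef (riccati_run X s).
Proof. by elim: s X => [//|b s IHs] X pX; apply: IHs; exact: riccati_semidef. Qed.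

(** At an arrival [C Y = 0] gives [(A - G C) Y = A Y] for every gain [G], so no filter reduces the
    part [Y]; the remaining terms are semidefinite. *)
Lemma riccati_ge (b : bool) X Y :
  possemidef X -> Y^t* = Y -> (b -> C *m Y = 0) -> possemidef (X - Y) ->
  possemidef (riccati X b - A *m Y *m A^t*).
Proof.
move=> pX hY CY pXY; have pQ' := posdef_semi pQ; have pV' := posdef_semi pV.
case: b CY => CY; last first.
  rewrite riccati_false addrAC -mulmxBl -mulmxBr.
  exact: (possemidefD (possemidef_congr _ pXY) pQ').
have [G ->] := riccati_true_gain pX.
have -> : A *m Y *m A^t* = (A - G *m C) *m Y *m (A - G *m C)^t*.
  have YC : Y *m C^t* = 0 by rewrite -hY -ctmxM CY // trmx0 map_mx0.
  rewrite mulmxBl -[G *m C *m Y]mulmxA CY // mulmx0 subr0 ctmxB ctmxM mulmxBr.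
  by rewrite !mulmxA -[A *m Y *m C^t*]mulmxA YC mulmx0 mul0mx subr0.
rewrite /joseph addrAC [_ + Q - _]addrAC -mulmxBl -mulmxBr.
exact: (possemidefD (possemidefD (possemidef_congr _ pXY) pQ')
                    (possemidef_congr _ pV')).
Qed.

(** [Psi] is a product of closed-loop matrices along [s], and [M] is uniform in [X]. With [Psi = 0]
    the covariance after [s] is bounded independently of the one before. *)
Definition dominated s (Psi : 'M[R[i]]_n) : Prop :=
  exists M, forall X, possemidef X ->
    possemidef (Psi *m X *m Psi^t* + M - riccati_run X s).

Lemma dominated_nil : dominated [::] 1%:M.
Proof.
by exists 0 => X pX; rewrite mul1mx ctmx1 mulmx1 addr0 subrr; exact: possemidef0.
Qed.

Lemma dominated_gain s Psi F N b : dominated s Psi ->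
    (forall X, possemidef X -> possemidef (F *m X *m F^t* + N - riccati X b)) ->
  dominated (rcons s b) (F *m Psi).
Proof.
move=> [M hM] hF; exists (F *m M *m F^t* + N) => X pX.
have := possemidefD (possemidef_congr F (hM X pX))
                    (hF _ (riccati_run_semidef s pX)).
rewrite riccati_run_rcons; congr possemidef.
rewrite mulmxBr mulmxDr mulmxBl mulmxDl ctmxM !mulmxA.
move: (_ *m riccati_run _ _ *m _) => U.
by apply/matrixP => i j; rewrite !mxE; ring.
Qed.

Lemma dominated_openloop s Psi b : dominated s Psi ->
  dominated (rcons s b) (A *m Psi).
Proof.
move=> sP; apply: (dominated_gain (N := Q) sP) => X; exact: riccati_openloop_le.
Qed.

Lemma dominated_update s Psi K : dominated s Psi ->
  dominated (rcons s true) ((A - K *m C) *m Psi).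
Proof.
move=> sP; apply: (dominated_gain (N := Q + K *m V *m K^t*) sP) => X pX.
by have := riccati_true_le K pX; rewrite /joseph addrA.
Qed.

End Riccati.

(** * Averages over Bernoulli sequences *)

Section BernoulliAverage.
Variables (R : realType) (p : R).
Implicit Types (F G : seq bool -> R) (s t : seq bool).

(** The expectation of [F] over [k] independent Bernoulli bits. The last bit is peeled off because a
    Riccati run is extended at that end. *)
Fixpoint bernoulli_mean k F : R :=
  if k is k'.+1 then
    (1 - p) * bernoulli_mean k' (fun s => F (rcons s false))
    + p * bernoulli_mean k' (fun s => F (rcons s true))
  else F [::].

Lemma eq_bernoulli_mean k F G :
  (forall s, size s = k -> F s = G s) ->
  bernoulli_mean k F = bernoulli_mean k G.
Proof.
elim: k F G => [|k IHk] F G FG /=; first exact: FG.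
by congr (_ * _ + _ * _); apply: IHk => s sk; apply: FG; rewrite size_rcons sk.
Qed.

Lemma bernoulli_mean_cst k c : bernoulli_mean k (fun=> c) = c.
Proof. by elim: k => //= k ->; rewrite -mulrDl subrK mul1r. Qed.

Lemma bernoulli_meanD k F G :
  bernoulli_mean k (fun s => F s + G s) = bernoulli_mean k F + bernoulli_mean k G.
Proof. by elim: k F G => //= k IHk F G; rewrite !IHk; ring. Qed.

Lemma bernoulli_meanZ k c F :
  bernoulli_mean k (fun s => c * F s) = c * bernoulli_mean k F.
Proof. by elim: k F => //= k IHk F; rewrite !IHk; ring. Qed.

Lemma bernoulli_mean_affine k c b F :
  bernoulli_mean k (fun s => c * F s + b) = c * bernoulli_mean k F + b.
Proof. by rewrite bernoulli_meanD bernoulli_meanZ bernoulli_mean_cst. Qed.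

Lemma bernoulli_mean_sum k I (r : seq I) (F : I -> seq bool -> R) :
  bernoulli_mean k (fun s => \sum_(i <- r) F i s)
  = \sum_(i <- r) bernoulli_mean k (F i).
Proof.
elim: r => [|i r IHr].
  rewrite big_nil -[RHS](bernoulli_mean_cst k).
  by apply: eq_bernoulli_mean => s _; rewrite big_nil.
rewrite big_cons -IHr -bernoulli_meanD.
by apply: eq_bernoulli_mean => s _; rewrite big_cons.
Qed.

Lemma bernoulli_mean_cat k l F :
  bernoulli_mean (k + l) F
  = bernoulli_mean k (fun s => bernoulli_mean l (fun t => F (s ++ t))).
Proof.
elim: l F => [|l IHl] F.
  by rewrite addn0; apply: eq_bernoulli_mean => s _; rewrite /= cats0.
rewrite addnS /= bernoulli_meanD !bernoulli_meanZ !IHl.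
congr (_ * _ + _ * _); apply: eq_bernoulli_mean => s _;
  by apply: eq_bernoulli_mean => t _; rewrite rcons_cat.
Qed.

Hypothesis p01 : 0 <= p <= 1.

Lemma le_bernoulli_mean k F G :
  (forall s, size s = k -> F s <= G s) ->
  bernoulli_mean k F <= bernoulli_mean k G.
Proof.
have [p0 p1] := andP p01.
elim: k F G => [|k IHk] F G FG /=; first exact: FG.
by apply: lerD; apply: ler_wpM2l; rewrite ?subr_ge0 //; apply: IHk => s sk;
  apply: FG; rewrite size_rcons sk.
Qed.

Lemma bernoulli_meanS_le k F G :
  (forall s, size s = k ->
     (1 - p) * F (rcons s false) + p * F (rcons s true) <= G s) ->
  bernoulli_mean k.+1 F <= bernoulli_mean k G.
Proof.
by move=> FG; rewrite /= -!bernoulli_meanZ -bernoulli_meanD le_bernoulli_mean.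
Qed.

End BernoulliAverage.

Definition observed_only_in (ok : pred nat) (s : seq bool) : bool :=
  all (fun j => nth false s j ==> ok j) (iota 0 (size s)).

Lemma observed_only_in_rcons ok s b :
  observed_only_in ok (rcons s b) = observed_only_in ok s && (b ==> ok (size s)).
Proof.
rewrite /observed_only_in size_rcons -addn1 iotaD all_cat /= andbT add0n.
rewrite nth_rcons ltnn eqxx; congr (_ && _); apply: eq_in_all => j.
by rewrite mem_iota add0n nth_rcons => /= ->.
Qed.

(** A time in [ok] is unconstrained, which gives a factor 1; at any other time the measurement must
    be lost, which gives [1 - p]. *)
Lemma bernoulli_mean_observed (R : realType) (p : R) k ok :
  bernoulli_mean p k (fun s => (observed_only_in ok s)%:R)
  = \prod_(0 <= j < k) (if ok j then 1 else 1 - p).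
Proof.
elim: k => [|k IHk]; first by rewrite big_nil.
rewrite big_nat_recr //= -IHk mulrC.
set e := bernoulli_mean p k (fun s => (observed_only_in ok s)%:R).
have -> : bernoulli_mean p k (fun s => (observed_only_in ok (rcons s false))%:R) = e.
  by apply: eq_bernoulli_mean => s _; rewrite observed_only_in_rcons andbT.
have -> : bernoulli_mean p k (fun s => (observed_only_in ok (rcons s true))%:R)
          = (ok k)%:R * e.
  rewrite -bernoulli_meanZ; apply: eq_bernoulli_mean => s sk.
  by rewrite observed_only_in_rcons sk /= -mulnb natrM mulrC.
by case: (ok k) => /=; ring.
Qed.

(** * Expectations over the arrival process as Bernoulli averages *)

Section Expectation.
Context d (T : measurableType d) (R : realType) (P : probability T R).
Variables (p : R) (gamma : nat -> {RV P >-> bool}).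
Hypothesis iid : iid_bernoulli p gamma.

Let weight (b : bool) : R := if b then p else 1 - p.

Fixpoint cylinder k (t : seq bool) : set T :=
  if t is b :: t' then (gamma k @^-1` [set b]) `&` cylinder k.+1 t' else setT.

Lemma measurable_arrival k (B : set bool) : measurable (gamma k @^-1` B).
Proof. by rewrite -[_ @^-1` _]setTI; exact: measurable_funP. Qed.

Lemma measurable_cylinder k t : measurable (cylinder k t).
Proof.
by elim: t k => [|b t IHt] k //=; apply: measurableI => //; exact: measurable_arrival.
Qed.

Lemma prob_arrival k b : P (gamma k @^-1` [set b]) = (weight b)%:E.
Proof.
have [g1 _] := iid; case: b; first exact: g1.
rewrite (_ : _ @^-1` _ = ~` [set w | gamma k w = true]).
  by rewrite probability_setC ?g1 //; exact: (measurable_arrival k [set true]).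
by apply/seteqP; split=> w /=; case: (gamma k w).
Qed.

(** Independence is stated for a family of sets indexed by all times; [g] extends the finite pattern
    [t] to such a family. *)
Lemma cylinderE t k (g : nat -> bool) :
    (forall i, (i < size t)%N -> g (k + i)%N = nth false t i) ->
  cylinder k t = \bigcap_(j in [set` iota k (size t)]) (gamma j @^-1` [set g j]).
Proof.
elim: t k => [|b t IHt] k gt; first by rewrite set_nil bigcap_set0.
have gk : g k = b by rewrite -[k]addn0 gt.
rewrite [cylinder _ _]/= (IHt k.+1) => [|i it]; last by rewrite addSnnS gt.
apply/seteqP; split=> [w [wk wt] j /=|w wt].
  by rewrite inE => /orP[/eqP->|jt]; [rewrite gk|exact: wt].
split; first by rewrite -gk; apply: wt => /=; rewrite mem_head.
by move=> j jt; apply: wt; rewrite /= inE jt orbT.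
Qed.

Lemma prob_cylinder k t : P (cylinder k t) = (\prod_(b <- t) weight b)%:E.
Proof.
have [_ ind] := iid.
pose g j := nth false t (j - k).
rewrite (@cylinderE _ _ g); last by move=> i _; rewrite /g addKn.
rewrite (ind _ (fun j => [set g j])) ?iota_uniq //.
rewrite (eq_bigr (fun j => (weight (g j))%:E)) => [|j _]; last exact: prob_arrival.
rewrite prodEFin; congr EFin.
rewrite [in RHS](big_nth false) -{1}[k]addn0 iotaDl big_map /index_iota subn0.
by apply: eq_bigr => j _; rewrite /g addKn.
Qed.

Lemma measurable_prefix k (F : seq bool -> R) :
  measurable_fun setT (fun w => F (mkseq (fun j => gamma j w) k)).
Proof.
elim: k F => [|k IHk] F; first exact: (measurable_cst (F [::])).
rewrite (_ : (fun w => _) = fun w => if gamma k w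
    then F (rcons (mkseq (fun j => gamma j w) k) true)
    else F (rcons (mkseq (fun j => gamma j w) k) false)).
  apply: measurable_fun_ifT; first exact: measurable_funP.
    exact: (IHk (fun s => F (rcons s true))).
  exact: (IHk (fun s => F (rcons s false))).
by apply/funext => w; rewrite mkseqS; case: (gamma k w).
Qed.

(* The tail cylinder makes the induction on [k] go through: conditioning on
   the arrival at time [k] moves it from the prefix to the cylinder. *)
Lemma integral_prefix_cylinder k (F : seq bool -> R) t :
  (\int[P]_(w in cylinder k t) (F (mkseq (fun j => gamma j w) k))%:E)%E
  = (bernoulli_mean p k F * \prod_(b <- t) weight b)%:E.
Proof.
elim: k F t => [|k IHk] F t.
  transitivity ((F [::])%:E * P (cylinder 0 t))%E; last by rewrite prob_cylinder.
  exact: (integral_cst P (measurable_cylinder 0 t) (F [::])%:E).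
have split_k : cylinder k.+1 t = cylinder k (false :: t) `|` cylinder k (true :: t).
  apply/seteqP; split=> w /=; last by case=> -[].
  by case: (gamma k w) => ?; [right|left].
have disj : [disjoint cylinder k (false :: t) & cylinder k (true :: t)].
  by apply/eqP; rewrite -subset0 => w [/= [gf _] [gt _]]; rewrite gf in gt.
rewrite split_k (integral_setU _ (measurable_cylinder k (false :: t))
  (measurable_cylinder k (true :: t)) _ disj); last first.
  apply/measurable_EFinP; apply: (measurable_funS measurableT (@subsetT _ _)).
  exact: measurable_prefix.
have step b : (\int[P]_(w in cylinder k (b :: t))
      (F (mkseq (fun j => gamma j w) k.+1))%:E)%E
    = (bernoulli_mean p k (fun s => F (rcons s b))
       * (weight b * \prod_(b <- t) weight b))%:E.
  have -> : weight b * \prod_(c <- t) weight c = \prod_(c <- b :: t) weight c.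
    by rewrite big_cons.
  rewrite -IHk; apply: eq_integral => w; rewrite inE => -[/= gb _].
  by rewrite mkseqS gb.
by rewrite !step -EFinD /=; congr EFin; ring.
Qed.

Lemma expectation_prefix k (F : seq bool -> R) :
  ('E_P[fun w => F (mkseq (fun j => gamma j w) k)])%E = (bernoulli_mean p k F)%:E.
Proof.
by rewrite unlock (integral_prefix_cylinder k F [::]) big_nil mulr1.
Qed.

End Expectation.

(** * The mean error covariance *)

Section RealPart.
Variable R : realType.
Implicit Types z : R[i].

Lemma ReD z w : complex.Re (z + w) = complex.Re z + complex.Re w.
Proof. by case: z w => [a b] [c d]. Qed.

Lemma ReB z w : complex.Re (z - w) = complex.Re z - complex.Re w.
Proof. by case: z w => [a b] [c d]. Qed.

Lemma ReZ (a : R) z : complex.Re (a%:C * z) = a * complex.Re z.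
Proof. by case: z => [c d] /=; rewrite mul0r subr0. Qed.

Lemma Re_ge0 z : 0 <= z -> 0 <= complex.Re z.
Proof. by rewrite lecE => /andP[]. Qed.

Lemma cmodE z : `|z| = (cmod z)%:C.
Proof. by rewrite /cmod RRe_real // normr_real. Qed.

Lemma cmod_ge0 z : 0 <= cmod z.
Proof. by apply: Re_ge0. Qed.

Lemma cmodM z w : cmod (z * w) = cmod z * cmod w.
Proof. by apply: complexI; rewrite rmorphM -!cmodE normrM. Qed.

Lemma cmodX z n : cmod (z ^+ n) = cmod z ^+ n.
Proof. by apply: complexI; rewrite rmorphXn -!cmodE normrX. Qed.

Lemma cmod_eq0 z : (cmod z == 0) = (z == 0).
Proof. by rewrite -(inj_eq (@complexI R)) -cmodE normr_eq0. Qed.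

Lemma mul_conj_cmod z : z * Num.conj z = (cmod z ^+ 2)%:C.
Proof. by rewrite -normCK cmodE rmorphXn. Qed.

Lemma Re_conj_mul z w :
  complex.Re (z * w * Num.conj z) = cmod z ^+ 2 * complex.Re w.
Proof. by rewrite mulrAC mul_conj_cmod ReZ. Qed.

End RealPart.

Section MatrixMean.
Variables (R : realType) (p : R) (m n : nat).

Definition mx_bernoulli_mean k (F : seq bool -> 'M[R[i]]_(m, n)) : 'M[R[i]]_(m, n) :=
  \matrix_(i, j) (bernoulli_mean p k (fun s => complex.Re (F s i j))
                  +i* bernoulli_mean p k (fun s => complex.Im (F s i j))).

Lemma mx_bernoulli_meanS k F :
  mx_bernoulli_mean k.+1 F
  = (1 - p)%:C *: mx_bernoulli_mean k (fun s => F (rcons s false))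
    + p%:C *: mx_bernoulli_mean k (fun s => F (rcons s true)).
Proof.
by apply/matrixP => i j; rewrite !mxE /=; simpc.
Qed.

End MatrixMean.

(** The semidefinite matrices form a convex cone, and the mean is an iterated convex combination. *)
Lemma possemidef_mean (R : realType) (p : R) n k (F : seq bool -> 'M[R[i]]_n) :
  0 <= p <= 1 -> (forall s, possemidef (F s)) ->
  possemidef (mx_bernoulli_mean p k F).
Proof.
move=> /andP[p0 p1]; elim: k F => [|k IHk] F pF.
  suff -> : mx_bernoulli_mean p 0 F = F [::] by [].
  by apply/matrixP => i j; rewrite mxE /=; case: (F [::] i j).
rewrite mx_bernoulli_meanS.
have q0 : 0 <= (1 - p)%:C by rewrite ler0c subr_ge0.
have q1 : 0 <= p%:C by rewrite ler0c.
exact: (possemidefD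
  (possemidefZ q0 (IHk (fun s => F (rcons s false)) (fun s => pF _)))
  (possemidefZ q1 (IHk (fun s => F (rcons s true)) (fun s => pF _)))).
Qed.

Section MeanCovariance.
Context (R : realType) (n m : nat).
Variables (A : 'M[R[i]]_n) (C : 'M[R[i]]_(m, n)).
Variables (Q : 'M[R[i]]_n) (V : 'M[R[i]]_m) (Sigma0 : 'M[R[i]]_n).
Variable p : R.

Let run := riccati_run A C Q V Sigma0.

Definition mean_diag i k : R :=
  bernoulli_mean p k (fun s => complex.Re (run s i i)).

Lemma mean_covE d (T : measurableType d) (P : probability T R)
    (gamma : nat -> {RV P >-> bool}) k :
  iid_bernoulli p gamma ->
  mean_cov A C Q V Sigma0 gamma k = mx_bernoulli_mean p k run.
Proof.
move=> iid; apply/matrixP => i j; rewrite !mxE.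
have e (f : R[i] -> R) :
    (fun w => f (error_cov A C Q V Sigma0 (fun j => gamma j w) k i j))
    = fun w => f (run (mkseq (fun j => gamma j w) k) i j).
  by apply/funext => w; rewrite error_covE.
rewrite (e (@complex.Re R)) (e (@complex.Im R)).
rewrite (expectation_prefix iid k (fun s => complex.Re (run s i j))).
by rewrite (expectation_prefix iid k (fun s => complex.Im (run s i j))).
Qed.

Hypotheses (pQ : posdef Q) (pV : posdef V) (pS : posdef Sigma0).
Hypothesis p01 : 0 <= p <= 1.

Let run_psd s : possemidef (run s).
Proof. by apply: riccati_run_semidef => //; exact: posdef_semi. Qed.

(** To refute boundedness it thus suffices that one diagonal entry of the mean diverges. *)
Lemma mean_cov_bounded_diag d (T : measurableType d) (P : probability T R)
    (gamma : nat -> {RV P >-> bool}) : iid_bernoulli p gamma ->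
  mean_cov_bounded A C Q V Sigma0 gamma ->
  forall i, exists B, forall k, mean_diag i k <= B.
Proof.
move=> iid [M hM] i; exists (complex.Re (M i i)) => k.
have := Re_ge0 (possemidef_diag i (hM k)).
by rewrite (mean_covE _ iid) !mxE ReB subr_ge0.
Qed.

Variables (ok : pred nat) (x : nat -> 'cV[R[i]]_n).
Hypothesis xS : forall k, x k.+1 = A *m x k.
Hypothesis x_unseen : forall k, ok k -> C *m x k = 0.

(** The rank-one matrix of the open-loop trajectory is carried along by [riccati_ge]: arrivals occur
    only at times when [C] annihilates the trajectory. *)
Lemma riccati_run_ge_unseen (c : R) s : 0 <= c ->
  possemidef (Sigma0 - c%:C *: (x 0 *m (x 0)^t*)) -> observed_only_in ok s ->
  possemidef (run s - c%:C *: (x (size s) *m (x (size s))^t*)).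
Proof.
move=> c0 px; elim/last_ind: s => [//|s b IHs].
rewrite observed_only_in_rcons size_rcons => /andP[/IHs {}IHs hb].
set Y := c%:C *: _ in IHs.
have -> : c%:C *: (x (size s).+1 *m (x (size s).+1)^t*) = A *m Y *m A^t*.
  by rewrite xS ctmxM /Y -scalemxAr -scalemxAl !mulmxA.
rewrite /run riccati_run_rcons.
apply: (@riccati_ge _ _ _ A C Q V pQ pV b (run s) Y); last exact: IHs.
- exact: run_psd.
- rewrite /Y ctmxZ ctmxM trmxCK conj_Creal //.
  by rewrite ger0_real // ler0c.
- move=> bT; rewrite bT /= in hb.
  by rewrite /Y -scalemxAr mulmxA x_unseen ?mul0mx ?scaler0.
Qed.

(** Restrict the mean to the sequences observed only in [ok], where the rank-one bound holds; on the
    others the diagonal entry is nonnegative. *)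
Lemma mean_diag_lower i : exists2 c : R, 0 < c & forall k,
  c * cmod (x k i 0) ^+ 2 * \prod_(0 <= j < k) (if ok j then 1 else 1 - p)
  <= mean_diag i k.
Proof.
have [c c0 px] := posdef_ge_rank1 (x 0) pS; exists c => // k.
rewrite -bernoulli_mean_observed -bernoulli_meanZ.
apply: (le_bernoulli_mean p01) => s sk.
have [os|_] := boolP (observed_only_in ok s); last first.
  by rewrite mulr0; exact: (Re_ge0 (possemidef_diag i (run_psd s))).
have := Re_ge0 (possemidef_diag i (riccati_run_ge_unseen (ltW c0) px os)).
rewrite sk mulr1 !mxE big_ord1 !mxE ReB subr_ge0 => /(le_trans _); apply.
by rewrite ReZ mul_conj_cmod.
Qed.

End MeanCovariance.

(** * Geometric growth and contraction of real sequences *)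

Lemma periodic_prod (R : comNzRingType) (f : nat -> R) q k :
  (forall j, f (j + q)%N = f j) ->
  \prod_(0 <= j < q * k) f j = (\prod_(0 <= j < q) f j) ^+ k.
Proof.
move=> fq; elim: k => [|k IHk]; first by rewrite muln0 big_nil.
rewrite mulnS (big_cat_nat (n := q)) ?leq_addr //= exprS -IHk; congr (_ * _).
rewrite -{1}[q]add0n big_addn addKn; apply: eq_bigr => j _; exact: fq.
Qed.

Lemma unbounded_geometric (R : archiRealFieldType) (c rho : R) :
  0 < c -> 1 < rho -> forall B, exists k, B < c * rho ^+ k.
Proof.
move=> c0 r1 B.
(* Bernoulli's inequality, which reduces the claim to the Archimedean property. *)
have bern k : 1 + (rho - 1) * k%:R <= rho ^+ k.
  elim: k => [|k IHk]; first by rewrite mulr0 addr0 expr0.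
  rewrite exprS -natr1; have : rho * (1 + (rho - 1) * k%:R) <= rho * rho ^+ k.
    by rewrite ler_pM2l //; lra.
  have : 0 <= (rho - 1) ^+ 2 * k%:R by rewrite mulr_ge0 ?sqr_ge0.
  by move: (k%:R) (rho ^+ k) => y z; nra.
pose k := Num.bound (B / (c * (rho - 1))).
exists k; have cr : 0 < c * (rho - 1) by rewrite mulr_gt0 // subr_gt0.
have : B < c * (rho - 1) * k%:R.
  rewrite mulrC -ltr_pdivrMr //.
  have [h|h] := leP 0 (B / (c * (rho - 1))); first exact: archi_boundP.
  exact: (lt_le_trans h).
by move=> h; have := bern k; nra.
Qed.

Lemma contraction_bounded (R : realFieldType) (u : nat -> R) N (rho beta : R) :
  (0 < N)%N -> 0 <= rho < 1 -> (forall k, u (k + N)%N <= rho * u k + beta) ->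
  exists2 B, 0 <= B & forall k, u k <= B.
Proof.
move=> N0 /andP[r0 r1] uN.
(* The sum dominates the [N] initial values, and [|beta| / (1 - rho)] is the fixed point of
   [y = rho y + |beta|]; strong induction then goes back [N] steps at a time. *)
pose B := \sum_(j < N) `|u j| + `|beta| / (1 - rho).
have b0 : 0 <= `|beta| / (1 - rho) by rewrite divr_ge0 // subr_ge0 ltW.
have s0 : 0 <= \sum_(j < N) `|u j| by rewrite sumr_ge0.
exists B => [|k]; first exact: addr_ge0.
have [j] := ubnP k; elim: j k => // j IHj k kj.
have [kN|kN] := ltnP k N.
  rewrite /B (bigD1 (Ordinal kN)) //= -addrA.
  apply: (le_trans (ler_norm _)); rewrite lerDl addr_ge0 //.
  by rewrite sumr_ge0.
have := uN (k - N)%N; rewrite subnK // => /le_trans; apply.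
have uB : u (k - N)%N <= B by apply: IHj; lia.
have rB : rho * u (k - N)%N <= rho * B by rewrite ler_wpM2l.
have bE : `|beta| / (1 - rho) * (1 - rho) = `|beta|.
  by rewrite divfK // gt_eqF // subr_gt0.
have : beta <= `|beta| by exact: ler_norm.
by rewrite /B in rB *; nra.
Qed.

(** * Boundedness for diagonal systems *)

Lemma diag_mx_exp (R : comNzRingType) n (l : 'rV[R]_n.+1) k :
  diag_mx l ^+ k = diag_mx (\row_i l 0 i ^+ k).
Proof.
elim: k => [|k IHk].
  by rewrite expr0; apply/matrixP => i j; rewrite !mxE expr0.
rewrite exprS IHk -[LHS]/(_ *m _) mulmx_diag; congr diag_mx.
by apply/rowP => i; rewrite !mxE exprS.
Qed.

Lemma ord2P (i : 'I_2) : i = 0 \/ i = 1.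
Proof. by case: i => -[|[|//]] ?; [left|right]; apply: val_inj. Qed.

Lemma geometric_lt1 (R : archiRealFieldType) (c rho : R) :
  0 <= rho < 1 -> exists2 n, (0 < n)%N & c * rho ^+ n < 1.
Proof.
move=> /andP[r0 r1]; have [->|rn0] := eqVneq rho 0.
  by exists 1%N => //; rewrite expr0n mulr0.
have rp : 0 < rho by rewrite lt0r rn0.
have r1' : 1 < rho^-1 by rewrite invf_gt1.
(* The growth of the powers of [rho^-1] is used; the 1 in the maximum rules out [n = 0]. *)
have [n hn] := unbounded_geometric ltr01 r1' (Num.max 1 c).
rewrite mul1r gt_max exprVn in hn; have /andP[n1 cn] := hn.
exists n; last by rewrite -ltr_pdivlMr ?exprn_gt0 // mul1r.
by case: n {hn cn} n1 => //; rewrite expr0 invr1 ltxx.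
Qed.

Lemma convex_comb_le (R : realDomainType) (p x y z : R) :
  0 <= p <= 1 -> x <= z -> y <= z -> (1 - p) * x + p * y <= z.
Proof. by move=> /andP[p0 p1] xz yz; nra. Qed.

Section DiagonalSystem.
Context (R : realType) (m : nat) (l : 'rV[R[i]]_2) (C : 'M[R[i]]_(m, 2)).
Variables (Q Sigma0 : 'M[R[i]]_2) (V : 'M[R[i]]_m) (p a : R).
Hypotheses (pQ : posdef Q) (pV : posdef V) (pS : posdef Sigma0).
Hypothesis p01 : 0 <= p <= 1.
Hypothesis l_le : forall i, cmod (l 0 i) <= a.

Local Notation A := (diag_mx l).
Local Notation run := (riccati_run A C Q V).
Local Notation D := (mean_diag A C Q V Sigma0 p).

(** A semidefinite [M] lies below [(\tr M) I], so bounds on the diagonal entries suffice. *)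
Lemma mean_cov_boundedW d (T : measurableType d) (P : probability T R)
    (gamma : nat -> {RV P >-> bool}) : iid_bernoulli p gamma ->
  (forall i, exists B, forall k, D i k <= B) ->
  mean_cov_bounded A C Q V Sigma0 gamma.
Proof.
move=> iid hB; have [B0 hB0] := hB 0; have [B1 hB1] := hB 1.
exists ((B0 + B1)%:C%:M) => k; rewrite (mean_covE _ _ _ _ _ k iid).
set M := mx_bernoulli_mean _ _ _.
have pM : possemidef M.
  apply: possemidef_mean => // s; apply: (riccati_run_semidef _ _ pQ pV).
  exact: posdef_semi.
have pT : 0 <= (B0 + B1)%:C - \tr M.
  have trE : \tr M = (D 0 k + D 1 k)%:C.
    have := RRe_real (ger0_real (_ : 0 <= \tr M)) => <-.
      rewrite /mxtrace big_ord_recl big_ord1 ReD !mxE; congr (_ + _)%:C.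
      by rewrite /mean_diag; congr bernoulli_mean; apply/funext => s;
        congr (complex.Re (_ _ _)); apply: val_inj.
    by rewrite sumr_ge0 // => i _; exact: possemidef_diag.
  by rewrite trE -rmorphB ler0c subr_ge0 lerD.
have := possemidefD (possemidef_scalar 2 pT) (possemidef_le_trace pM).
by rewrite raddfB /= addrA subrK.
Qed.

Lemma Re_diag_congr (M : 'M[R[i]]_2) i :
  complex.Re ((A *m M *m A^t*) i i) = cmod (l 0 i) ^+ 2 * complex.Re (M i i).
Proof.
rewrite tr_diag_mx map_diag_mx mul_mx_diag mul_diag_mx !mxE.
exact: Re_conj_mul.
Qed.

Lemma Re_diag_le (M N : 'M[R[i]]_2) i : possemidef (M - N) ->
  complex.Re (N i i) <= complex.Re (M i i).
Proof. by move=> /possemidef_diag-/(_ i)/Re_ge0; rewrite !mxE ReB subr_ge0. Qed.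

(** Since [A] is diagonal, the open-loop bound is a scalar recursion in each diagonal entry. *)
Lemma riccati_diag_le b X i : possemidef X ->
  complex.Re (riccati A C Q V X b i i)
  <= cmod (l 0 i) ^+ 2 * complex.Re (X i i) + complex.Re (Q i i).
Proof.
move=> pX; have := Re_diag_le i (riccati_openloop_le A C Q pV b pX).
by rewrite [X in _ <= complex.Re X]mxE ReD Re_diag_congr.
Qed.

Let a0 : 0 <= a. Proof. exact: le_trans (cmod_ge0 _) (l_le 0). Qed.

Lemma riccati_run_diag_le s i : exists B, forall X, possemidef X ->
  complex.Re (run X s i i) <= a ^+ (2 * size s) * complex.Re (X i i) + B.
Proof.
elim/last_ind: s => [|s b [B hB]].
  by exists 0 => X _; rewrite muln0 expr0 mul1r addr0.
exists (a ^+ 2 * B + complex.Re (Q i i)) => X pX.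
have pY : possemidef (run X s) by exact: (riccati_run_semidef _ _ pQ pV).
rewrite size_rcons mulnS exprD riccati_run_rcons.
apply: (le_trans (riccati_diag_le b i pY)).
rewrite addrA lerD2r -mulrA -mulrDr.
have h1 : cmod (l 0 i) ^+ 2 <= a ^+ 2.
  by rewrite ler_sqr ?nnegrE ?cmod_ge0.
have h2 := Re_ge0 (possemidef_diag i pY).
apply: (le_trans (ler_wpM2r h2 h1)); apply: ler_wpM2l; first exact: sqr_ge0.
exact: hB.
Qed.

(** A good window erases the past, and a bad one multiplies a diagonal entry by at most [a ^ (2N)]
    up to a constant. Averaging over the window makes the mean contract every [N] steps. *)
Lemma window_bounded N (bad : pred (seq bool)) : (0 < N)%N ->
    (forall s, size s = N -> ~~ bad s -> dominated A C Q V s 0) ->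
    a ^+ (2 * N) * bernoulli_mean p N (fun s => (bad s)%:R) < 1 ->
  forall i, exists B, forall k, D i k <= B.
Proof.
move=> N0 hdom hrho i.
have hs (s : seq bool) : exists B, size s = N -> forall X, possemidef X ->
    complex.Re (run X s i i)
    <= (bad s)%:R * a ^+ (2 * N) * complex.Re (X i i) + B.
  have [bs|bs] := boolP (bad s).
    have [B hB] := riccati_run_diag_le s i.
    by exists B => <- X pX; rewrite mul1r; exact: hB.
  (* [choice] below needs a bound for every list; for a list of another length 0 is a dummy
     value. *)
  have [sN|/eqP sN] := eqVneq (size s) N; last by exists 0.
  have [M hM] := hdom s sN bs.
  exists (complex.Re (M i i)) => _ X pX; rewrite !mul0r add0r.
  by have := Re_diag_le i (hM X pX); rewrite !mul0mx add0r.
have [B hB] := choice hs.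
pose rho := a ^+ (2 * N) * bernoulli_mean p N (fun s => (bad s)%:R).
have rho0 : 0 <= rho.
  rewrite mulr_ge0 ?exprn_ge0 // -(bernoulli_mean_cst p N 0).
  by apply: (le_bernoulli_mean p01).
have [|k|b _ hb] := @contraction_bounded R (D i) N rho (bernoulli_mean p N B) N0.
- by rewrite rho0.
- rewrite /mean_diag bernoulli_mean_cat -bernoulli_meanZ.
  rewrite -[X in _ + X](bernoulli_mean_cst p k) -bernoulli_meanD.
  apply: (le_bernoulli_mean p01) => s _.
  set X := riccati_run _ _ _ _ _ s.
  have pX : possemidef X by apply: (riccati_run_semidef _ _ pQ pV); exact: posdef_semi.
  rewrite mulrAC [_ * complex.Re _]mulrC -bernoulli_meanZ -bernoulli_meanD.
  apply: (le_bernoulli_mean p01) => t tN; rewrite riccati_run_cat -/X.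
  by apply: (le_trans (hB t tN X pX)); rewrite lerD2r; lra.
- by exists b.
Qed.

Lemma stable_bounded : a < 1 -> forall i, exists B, forall k, D i k <= B.
Proof.
(* Every window of length 1 may be counted as bad, since the open-loop factor is already below 1. *)
move=> a1; apply: (@window_bounded 1 predT) => //.
by rewrite bernoulli_mean_cst mulr1 exprn_ilt1.
Qed.

(** Here [C] has a left inverse, so the gain [A *m pinvmx C] makes [A - K C] vanish: one arrival is
    deadbeat, and the only bad window of length 1 is a loss. *)
Lemma full_rank_bounded : \rank C = 2%N -> a ^+ 2 * (1 - p) < 1 ->
  forall i, exists B, forall k, D i k <= B.
Proof.
move=> rC ap; apply: (@window_bounded 1 (fun s => ~~ head false s)) => //.
  case=> // -[] [] // _ _.
  have CC : pinvmx C *m C = 1%:M by rewrite mulVpmx // -col_leq_rank rC.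
  have := dominated_update pQ pV (A *m pinvmx C) (dominated_nil A C Q V).
  by rewrite -mulmxA CC !mulmx1 subrr.
by rewrite /= mulr0 mulr1 addr0.
Qed.

Lemma dominated_cat s t Psi : dominated A C Q V s Psi ->
  dominated A C Q V (s ++ t) (A ^+ size t *m Psi).
Proof.
move=> sP; elim/last_ind: t => [|t b IHt]; first by rewrite cats0 expr0 mul1mx.
rewrite -rcons_cat size_rcons exprS -[_ * _]/(_ *m _) -mulmxA.
exact: dominated_openloop.
Qed.

(* [1 - z1 c] projects onto the line [ker c]; [A ^+ u] moves this line out of
   [ker c], and [z2] is chosen along its image. *)
Lemma deadbeat (c : 'rV[R[i]]_2) u :
    c 0 0 != 0 -> c 0 1 != 0 -> l 0 0 ^+ u != l 0 1 ^+ u ->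
  exists z1 z2 : 'cV[R[i]]_2,
    (1%:M - z2 *m c) *m A ^+ u *m (1%:M - z1 *m c) = 0.
Proof.
move=> c0 c1 lu.
pose z1 : 'cV[R[i]]_2 := \col_i (if i == 0 then (c 0 0)^-1 else 0).
pose n : 'cV[R[i]]_2 := \col_i (if i == 0 then - c 0 1 else c 0 0).
pose e : 'rV[R[i]]_2 := \row_i (if i == 0 then 0 else (c 0 0)^-1).
have E1 : 1%:M - z1 *m c = n *m e.
  apply/matrixP => i j; rewrite !mxE !big_ord1 !mxE.
  by have [->|->] := ord2P i; have [->|->] := ord2P j; rewrite /=; field.
pose v := A ^+ u *m n.
pose s : R[i] := (c *m v) 0 0.
have sE : c *m v = s%:M by rewrite [LHS]mx11_scalar.
have s0 : s != 0.
  have -> : s = c 0 0 * c 0 1 * (l 0 1 ^+ u - l 0 0 ^+ u).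
    rewrite /s /v diag_mx_exp mul_diag_mx !mxE big_ord_recl big_ord1 !mxE.
    by rewrite (_ : lift 0 0 = 1) /=; [ring|exact: val_inj].
  by rewrite !mulf_neq0 // subr_eq0 eq_sym.
exists z1; exists (s^-1 *: v).
rewrite E1 !mulmxA -[_ *m A ^+ u *m n]mulmxA -/v mulmxBl mul1mx.
rewrite -!scalemxAl -mulmxA sE mul_mx_scalar scalerA mulVf // scale1r subrr.
by rewrite mul0mx.
Qed.

(** The row [h] merges the measurements into one scalar output that sees both modes, to which
    [deadbeat] applies. The lag is [(size s2).+1]: the first update itself contributes one factor
    [A]. *)
Lemma two_observations_dominated (h : 'rV[R[i]]_m) s1 s2 s3 :
    (h *m C) 0 0 != 0 -> (h *m C) 0 1 != 0 ->
    l 0 0 ^+ (size s2).+1 != l 0 1 ^+ (size s2).+1 ->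
  dominated A C Q V (s1 ++ true :: s2 ++ true :: s3) 0.
Proof.
move=> h0 h1 /(deadbeat h0 h1)[z1 [z2 z0]].
have gain z : A - A *m z *m h *m C = A *m (1%:M - z *m (h *m C)).
  by rewrite mulmxBr mulmx1 !mulmxA.
have -> : s1 ++ true :: s2 ++ true :: s3 = rcons (rcons s1 true ++ s2) true ++ s3.
  by rewrite -!cats1 -!catA.
have := dominated_cat s1 (dominated_nil A C Q V).
move/(dominated_update pQ pV (A *m z1 *m h)); rewrite gain.
move/(dominated_cat s2)/(dominated_update pQ pV (A *m z2 *m h)); rewrite gain.
move/(dominated_cat s3); rewrite cat0s mulmx1; congr dominated.
move: (1%:M - _) (1%:M - _) z0 => E1 E2 z0.
transitivity (A ^+ size s3 *m A *m (E2 *m A ^+ (size s2).+1 *m E1) *m A ^+ size s1).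
  by rewrite exprSr -[_ * _]/(_ *m _) !mulmxA.
by rewrite z0 mulmx0 mul0mx.
Qed.

Definition one_class q (s : seq bool) : bool :=
  [exists r : 'I_q, observed_only_in (fun j => j %% q == r)%N s].

Lemma two_classes q (s : seq bool) : (0 < q)%N -> ~~ one_class q s ->
  exists s1 s2 s3, s = s1 ++ true :: s2 ++ true :: s3 /\ ~~ (q %| (size s2).+1)%N.
Proof.
move=> q0; rewrite negb_exists => /forallP hs.
have other r : (r < q)%N -> exists2 j, nth false s j & (j %% q != r)%N.
  move=> rq; have := hs (Ordinal rq); rewrite /observed_only_in => /allPn[j _].
  by rewrite negb_imply => /andP[]; exists j.
(* [i] is just some arrival, obtained by excluding class 0; [j] is an arrival outside the class of
   [i]. *)
have [i si _] := other 0%N q0; have [j sj ij] := other (i %% q)%N (ltn_pmod _ q0).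
have lt_size k : nth false s k -> (k < size s)%N.
  by move=> sk; rewrite ltnNge; apply/negP => /(nth_default false) e; rewrite e in sk.
wlog lt_ij : i j si sj ij / (i < j)%N.
  move=> w; have [|ji|eij] := ltngtP i j; first exact: w.
    by apply: (w j i) => //; rewrite eq_sym.
  by rewrite eij eqxx in ij.
exists (take i s), (take (j - i.+1) (drop i.+1 s)), (drop j.+1 s); split.
  rewrite -{1}[s](cat_take_drop i) (drop_nth false (lt_size i si)) si.
  rewrite -{1}[drop i.+1 s](cat_take_drop (j - i.+1)) drop_drop subnK //.
  by rewrite (drop_nth false (lt_size j sj)) sj.
rewrite size_takel; last first.
  by rewrite size_drop leq_sub2r // ltnW // lt_size.
rewrite subnSK // -eqn_mod_dvd; last exact: ltnW.
exact: ij.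
Qed.

Lemma prod_one_class q r : (r < q)%N ->
  \prod_(0 <= j < q) (if (j %% q == r)%N then 1 else 1 - p) = (1 - p) ^+ q.-1.
Proof.
move=> rq; rewrite big_mkord (bigD1 (Ordinal rq)) //= modn_small // eqxx mul1r.
rewrite (eq_bigr (fun=> 1 - p)) => [|j jr]; last first.
  by rewrite modn_small // ifN // -(inj_eq val_inj).
by rewrite prodr_const cardC1 card_ord.
Qed.

(** Union bound over the [q] residue classes; in each period, [q - 1] measurements must be lost. *)
Lemma mean_one_class q n :
  bernoulli_mean p (q * n) (fun s => (one_class q s)%:R)
  <= q%:R * ((1 - p) ^+ q.-1) ^+ n.
Proof.
apply: (@le_trans _ _ (bernoulli_mean p (q * n) (fun s => \sum_(r < q)
    (observed_only_in (fun j => j %% q == r)%N s)%:R))).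
  apply: (le_bernoulli_mean p01) => s _; rewrite /one_class.
  case: existsP => [[r hr]|_]; last by rewrite sumr_ge0.
  by rewrite (bigD1 r) //= hr lerDl sumr_ge0.
rewrite bernoulli_mean_sum (eq_bigr (fun=> ((1 - p) ^+ q.-1) ^+ n)) => [|r _].
  by rewrite sumr_const card_ord mulr_natl.
rewrite bernoulli_mean_observed periodic_prod => [|j]; last by rewrite modnDr.
by rewrite prod_one_class.
Qed.

Lemma observable_bounded q (h : 'rV[R[i]]_m) : (0 < q)%N ->
    (h *m C) 0 0 != 0 -> (h *m C) 0 1 != 0 ->
    (forall u, ~~ (q %| u)%N -> l 0 0 ^+ u != l 0 1 ^+ u) ->
    a ^+ (2 * q) * (1 - p) ^+ q.-1 < 1 ->
  forall i, exists B, forall k, D i k <= B.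
Proof.
move=> q0 h0 h1 lu rho1.
have p1 : 0 <= 1 - p by rewrite subr_ge0; case/andP: p01.
have rho01 : 0 <= a ^+ (2 * q) * (1 - p) ^+ q.-1 < 1.
  by rewrite rho1 mulr_ge0 ?exprn_ge0.
(* A long window absorbs the factor [q] of the union bound. *)
have [n n0 hn] := geometric_lt1 q%:R rho01.
apply: (@window_bounded (q * n) (one_class q)); first by rewrite muln_gt0 q0.
  move=> s _ /(two_classes q0)[s1 [s2 [s3 [-> /lu hl]]]].
  exact: (two_observations_dominated _ _ h0 h1 hl).
apply: le_lt_trans hn; rewrite exprMn mulrCA mulnA exprM.
by rewrite ler_wpM2l ?exprn_ge0 // mean_one_class.
Qed.

(* With the second mode stable, cancelling the first mode at each arrival
   makes the mean recursion triangular. *)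
Lemma triangular_bounded j : C j 0 != 0 -> cmod (l 0 1) < 1 ->
    a ^+ 2 * (1 - p) < 1 ->
  forall i, exists B, forall k, D i k <= B.
Proof.
move=> Cj0 l1 ap; have [p0 p1] := andP p01.
have run_psd s : possemidef (run Sigma0 s).
  by apply: (riccati_run_semidef _ _ pQ pV); exact: posdef_semi.
(* The second entry contracts by the open-loop bound alone, with or without arrivals. *)
have D1S k : D 1 (k + 1)%N <= cmod (l 0 1) ^+ 2 * D 1 k + complex.Re (Q 1 1).
  rewrite addn1 /mean_diag -bernoulli_mean_affine.
  apply: (bernoulli_meanS_le p01) => s _; rewrite !riccati_run_rcons.
  by apply: (convex_comb_le p01); apply: riccati_diag_le.
have [|B1 B10 hB1] := contraction_bounded (isT : (0 < 1)%N) _ D1S.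
  by rewrite sqr_ge0 expr_lt1 ?cmod_ge0.
(* The gain uses the [j]-th measurement only, scaled so that the top left entry of [A - K C]
   vanishes. *)
pose z : 'cV[R[i]]_2 := \col_i (if i == 0 then l 0 0 / C j 0 else 0).
have [M hM] := dominated_update pQ pV (z *m delta_mx 0 j) (dominated_nil A C Q V).
set Psi := _ *m 1%:M in hM.
have Psi00 : Psi 0 0 = 0.
  rewrite /Psi mulmx1 -mulmxA -rowE !mxE big_ord1 !mxE /=.
  by rewrite divfK // mulr1n subrr.
clearbody Psi; have Psi_diag X : complex.Re ((Psi *m X *m Psi^t*) 0 0)
    = cmod (Psi 0 1) ^+ 2 * complex.Re (X 1 1).
  rewrite -Re_conj_mul; congr complex.Re; rewrite !mxE big_ord_recl big_ord1 !mxE.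
  rewrite !big_ord_recl !big_ord0 (_ : lift 0 0 = 1); last exact: val_inj.
  by rewrite Psi00 conjC0; ring.
(* A loss contributes the factor [|l_0|^2] with probability [1 - p]; an arrival replaces the first
   entry by a multiple of the second, already bounded in mean by [B1]. *)
have D0S k : D 0 (k + 1)%N <= cmod (l 0 0) ^+ 2 * (1 - p) * D 0 k
    + (complex.Re (Q 0 0) + cmod (Psi 0 1) ^+ 2 * B1 + `|complex.Re (M 0 0)|).
  have q0 : 0 <= 1 - p by rewrite subr_ge0.
  pose b := cmod (Psi 0 1) ^+ 2; have b0 : 0 <= b by exact: sqr_ge0.
  apply: (@le_trans _ _ (cmod (l 0 0) ^+ 2 * (1 - p) * D 0 k
            + (b * D 1 k + (complex.Re (Q 0 0) + `|complex.Re (M 0 0)|)))).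
    rewrite addn1 /mean_diag -[b * _ + _]bernoulli_mean_affine -bernoulli_meanZ.
    rewrite -bernoulli_meanD; apply: (bernoulli_meanS_le p01) => s _.
    rewrite !riccati_run_rcons.
    have h0 := ler_wpM2l q0 (riccati_diag_le false 0 (run_psd s)).
    have h1 := Re_diag_le 0 (hM _ (run_psd s)).
    rewrite [X in _ <= complex.Re X]mxE ReD Psi_diag in h1.
    have {}h1 := ler_wpM2l p0 h1.
    have x1 := Re_ge0 (possemidef_diag 1 (run_psd s)).
    have Q0 := Re_ge0 (possemidef_diag 0 (posdef_semi pQ)).
    apply: (le_trans (lerD h0 h1)); rewrite -/b in h1 *.
    have bx : 0 <= b * complex.Re (run Sigma0 s 1 1) by rewrite mulr_ge0.
    have q1 : 1 - p <= 1 by rewrite lerBlDr lerDl.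
    have e1 := ler_piMl Q0 q1; have e2 := ler_piMl bx p1.
    have e3 := le_trans (ler_wpM2l p0 (ler_norm (complex.Re (M 0 0))))
                        (ler_piMl (normr_ge0 _) p1).
    rewrite mulrDr mulrA [(1 - p) * cmod _ ^+ 2]mulrC [p * (_ + _)]mulrDr.
    rewrite -addrA lerD2l addrCA.
    exact: (lerD e2 (lerD e1 e3)).
  apply: lerD => //; rewrite -addrA [leRHS]addrCA; apply: lerD => //.
  exact: (ler_wpM2l b0 (hB1 k)).
have [|B0 _ hB0] := contraction_bounded (isT : (0 < 1)%N) _ D0S.
  have q0 : 0 <= 1 - p by rewrite subr_ge0.
  rewrite mulr_ge0 ?sqr_ge0 //=; apply: le_lt_trans ap.
  by rewrite ler_wpM2r // ler_sqr ?nnegrE ?cmod_ge0.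
by move=> i; have [->|->] := ord2P i; [exists B0|exists B1].
Qed.

End DiagonalSystem.

(** * Roots of unity, detectability and unboundedness *)

Section RootsOfUnity.
Variable R : realType.
Implicit Types x phi : R.

Lemma expjX phi n : expj phi ^+ n = expj (n%:R * phi).
Proof.
elim: n => [|n IHn]; first by rewrite expr0 mul0r /expj cos0 sin0.
rewrite exprS IHn -natr1 mulrDl mul1r addrC /expj cosD sinD.
by simpc; congr (_ +i* _); ring.
Qed.

(** Reduce [x] to [y] in [[0, 2 pi)]. On [[0, pi]] the cosine is injective; beyond [pi] the sine
    does not vanish. *)
Lemma expj_eq1 x : 0 <= x ->
  expj x = 1 <-> exists k : nat, x = k%:R * (2 * pi).
Proof.
move=> x0; have pi0 := pi_gt0 R.
have shift (y : R) (k : nat) : expj (y + k%:R * (2 * pi)) = expj y.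
  have -> : k%:R * (2 * pi) = (pi *+ 2) *+ k :> R.
    by rewrite -[pi *+ 2]mulr_natl mulr_natl.
  by rewrite /expj (periodicn (@cosD2pi R)) (periodicn (@sinD2pi R)).
split=> [|[k ->]]; last by rewrite -[X in expj X]add0r shift /expj cos0 sin0.
pose k := Num.truncn (x / (2 * pi)); pose y := x - k%:R * (2 * pi).
have p2 : 0 < 2 * pi :> R by rewrite mulr_gt0.
have /andP[kx xk] : k%:R <= x / (2 * pi) < k.+1%:R.
  by apply: truncn_itv; rewrite divr_ge0 // ltW.
have y0 : 0 <= y by rewrite subr_ge0 -ler_pdivlMr.
have y2 : y < 2 * pi.
  by rewrite ltrBlDr addrC -{2}[2 * pi]mul1r -mulrDl natr1 -ltr_pdivrMr.
have xE : x = y + k%:R * (2 * pi) by rewrite subrK.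
rewrite xE shift => -[cy sy]; exists k.
suff -> : y = 0 by rewrite add0r.
have [ypi|piy] := leP y pi.
  apply: (@cos_inj R); rewrite ?in_itv /= ?y0 ?ypi ?lexx ?ltW //.
  by rewrite cy cos0.
have : 0 < sin (y - pi) by apply: sin_gt0_pi; apply/andP; split; lra.
by rewrite sinB cospi sinpi sy mulr0 mul0r subr0 ltxx.
Qed.

(* [expj phi] has multiplicative order [1 / DM], infinite when [DM = 0]. *)
Lemma expj_order phi : 0 <= phi ->
  (DM (phi / (2 * pi)) = 0 /\ forall u, (0 < u)%N -> expj phi ^+ u != 1)
  \/ exists q, [/\ (0 < q)%N, DM (phi / (2 * pi)) = q%:R^-1
                & forall u, (expj phi ^+ u == 1) = (q %| u)%N].
Proof.
move=> phi0; set x := phi / _.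
have p2 : 0 < 2 * pi :> R by rewrite mulr_gt0 ?pi_gt0.
have x0 : 0 <= x by rewrite divr_ge0 // ltW.
have order1 u : expj phi ^+ u = 1 <-> exists k : nat, u%:R * x = k%:R.
  rewrite expjX; split.
    move/expj_eq1 => [|k kE]; first by rewrite mulr_ge0.
    by exists k; rewrite /x mulrA kE mulfK // gt_eqF.
  move=> [k kE]; apply/expj_eq1; first by rewrite mulr_ge0.
  by exists k; rewrite -kE /x -mulrA divfK // gt_eqF.
rewrite /DM; case: pselect => [ex|nex]; [right|left]; last first.
  split=> // u u0; apply/eqP => /order1[k kE]; apply: nex.
  exists (k%:R / u%:R); rewrite fmorph_div /= !ratr_nat -kE mulrAC mulfV ?mul1r //.
  by rewrite pnatr_eq0 -lt0n.
case: cid => r /= xr; have r0 : 0 <= r by rewrite -(ler0q R) -xr.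
have dE : denq r = `|denq r|%N by rewrite gez0_abs ?denq_ge0.
exists `|denq r|%N; split.
- by rewrite absz_gt0 denq_neq0.
- by rewrite {1}dE.
move=> u; apply/eqP/idP => [/order1[k kE]|/dvdnP[v ->]].
  have {}kE : u%:R * r = k%:R :> rat.
    by apply: (fmorph_inj (@ratr R)); rewrite rmorphM /= !ratr_nat -xr.
  have : (denq r %| u%:Z * numq r)%Z.
    apply/dvdzP; exists k%:Z; apply: (intr_inj (R := rat)).
    rewrite !intrM /= -!pmulrn -kE -mulrA; congr (_ * _).
    exact: numqE.
  by rewrite Gauss_dvdzl // coprimezE coprime_sym coprime_num_den.
apply/order1; exists (v * `|numq r|)%N; rewrite xr -(ratr_nat R).
rewrite -(ratr_nat R (v * _)) -rmorphM; congr ratr.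
have nE : numq r = `|numq r|%N by rewrite gez0_abs ?numq_ge0.
rewrite !natrM -mulrA; congr (_ * _); by rewrite !pmulrn -nE -dE mulrC numqE.
Qed.

End RootsOfUnity.

Section CriticalValue.
Context (R : realType) (m : nat).
Implicit Types (l : 'rV[R[i]]_2) (C : 'M[R[i]]_(m, 2)).

(** On [ker C] the matrices [A - L C] and [A] agree, so no [L] can move the eigenvalue [a]. As
    [eigenvalue] refers to row vectors, the proof goes through the non-invertibility of
    [A - L C - a]. *)
Lemma detectable_eigen (A : 'M[R[i]]_2) C (x : 'cV[R[i]]_2) a :
  detectable C A -> x != 0 -> C *m x = 0 -> A *m x = a *: x -> cmod a < 1.
Proof.
move=> [L sL] x0 Cx Ax; apply: sL; rewrite /eigenvalue kermx_eq0 row_free_unit.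
apply: contraNN x0 => uF; rewrite -(mulKmx uF x).
by rewrite !mulmxBl -mulmxA Cx mulmx0 subr0 Ax mul_scalar_mx subrr mulmx0.
Qed.

Lemma detectable_column l C i : detectable C (diag_mx l) ->
  1 <= cmod (l 0 i) -> exists j, C j i != 0.
Proof.
move=> dC l1; apply/existsP; apply: contraLR l1 => /existsPn C0; rewrite -ltNge.
apply: (@detectable_eigen (diag_mx l) C (delta_mx i 0) (l 0 i) dC).
- by apply/eqP => /matrixP/(_ i 0)/eqP; rewrite !mxE !eqxx oner_eq0.
- by rewrite -colE; apply/colP => j; rewrite !mxE; apply/eqP/negPn.
- apply/colP => j; rewrite mul_diag_mx !mxE.
  by have [->//|_] := eqVneq j i; rewrite !mulr0.
Qed.

(** If neither row serves alone, each has a zero where the other does not, and their sum serves. *)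
Lemma both_columns_row C j0 j1 : C j0 0 != 0 -> C j1 1 != 0 ->
  exists h : 'rV[R[i]]_m, (h *m C) 0 0 != 0 /\ (h *m C) 0 1 != 0.
Proof.
move=> C0 C1; have [z01|n01] := eqVneq (C j0 1) 0; last first.
  by exists (delta_mx 0 j0); rewrite -rowE !mxE.
have [z10|n10] := eqVneq (C j1 0) 0; last first.
  by exists (delta_mx 0 j1); rewrite -rowE !mxE.
exists (delta_mx 0 j0 + delta_mx 0 j1); rewrite mulmxDl -!rowE !mxE.
by rewrite z01 z10 addr0 add0r.
Qed.

Lemma rank_lt2_kernel C : \rank C != 2%N ->
  exists2 x : 'cV[R[i]]_2, x != 0 & C *m x = 0.
Proof.
move=> rC; have : kermx C^T != 0.
  rewrite kermx_eq0 -row_leq_rank mxrank_tr -ltnNge ltn_neqAle rC.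
  exact: rank_leq_col.
case/rowV0Pn => v vk v0; exists v^T; first by rewrite trmx_eq0.
by apply: trmx_inj; rewrite trmx_mul trmxK trmx0; apply/sub_kermxP.
Qed.

Section Unbounded.
Variables (l : 'rV[R[i]]_2) (C : 'M[R[i]]_(m, 2)).
Variables (Q Sigma0 : 'M[R[i]]_2) (V : 'M[R[i]]_m) (p : R).
Hypotheses (pQ : posdef Q) (pV : posdef V) (pS : posdef Sigma0).
Hypothesis p01 : 0 <= p <= 1.
Context d (T : measurableType d) (P : probability T R).
Variable gamma : nat -> {RV P >-> bool}.
Hypothesis iid : iid_bernoulli p gamma.

(** Over one period the squared growth of mode [i], times the probability of no arrival outside
    [ok], exceeds 1; the lower bound therefore diverges along multiples of [q]. *)
Lemma unseen_unbounded q (ok : pred nat) (x : 'cV[R[i]]_2) i :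
    (forall k, ok k -> C *m (diag_mx l ^+ k *m x) = 0) ->
    (forall k, ok (k + q)%N = ok k) -> x i 0 != 0 ->
    1 < cmod (l 0 i) ^+ (2 * q) * \prod_(0 <= j < q) (if ok j then 1 else 1 - p) ->
  ~ mean_cov_bounded (diag_mx l) C Q V Sigma0 gamma.
Proof.
move=> unseen okq xi rho1 /(mean_cov_bounded_diag iid)/(_ i)[B hB].
have xS k : diag_mx l ^+ k.+1 *m x = diag_mx l *m (diag_mx l ^+ k *m x).
  by rewrite mulmxA exprS.
have [c c0 hc] := mean_diag_lower pQ pV pS p01 xS unseen i.
have cx : 0 < c * cmod (x i 0) ^+ 2.
  by rewrite mulr_gt0 // exprn_gt0 // lt_neqAle eq_sym cmod_eq0 xi cmod_ge0.
have [k] := unbounded_geometric cx rho1 B; apply/negP; rewrite -leNgt.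
apply: le_trans (hB (q * k)%N); apply: le_trans (hc (q * k)%N).
rewrite periodic_prod => [|j]; last by rewrite okq.
rewrite diag_mx_exp mul_diag_mx !mxE cmodM cmodX !exprMn -!exprM.
rewrite [(q * k * 2)%N]mulnC mulnA.
move: (cmod (l 0 i) ^+ (2 * q * k)) (_ ^+ k) => y z.
by rewrite le_eqVlt; apply/orP; left; apply/eqP; ring.
Qed.

Lemma unobserved_unbounded :
  1 < cmod (l 0 0) ^+ 2 * (1 - p) ->
  ~ mean_cov_bounded (diag_mx l) C Q V Sigma0 gamma.
Proof.
move=> h; apply: (@unseen_unbounded 1 pred0 (delta_mx 0 0) 0) => //.
  by rewrite mxE !eqxx oner_eq0.
by rewrite big_nat1.
Qed.

(** At multiples of [q] the power of [A] is scalar, so a trajectory started in [ker C] returns to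
    [ker C]. The moduli agree, hence any nonzero coordinate of [x] serves. *)
Lemma resonant_unbounded q : (0 < q)%N -> \rank C != 2%N ->
    cmod (l 0 1) = cmod (l 0 0) -> l 0 0 ^+ q = l 0 1 ^+ q ->
    1 < cmod (l 0 0) ^+ (2 * q) * (1 - p) ^+ q.-1 ->
  ~ mean_cov_bounded (diag_mx l) C Q V Sigma0 gamma.
Proof.
move=> q0 rC eql lq rho1.
have [x x0 Cx] := rank_lt2_kernel rC.
have [i xi] : exists i, x i 0 != 0.
  by case/cV0Pn: x0 => i; exists i.
have li : cmod (l 0 i) = cmod (l 0 0) by have [->|->] := ord2P i.
apply: (@unseen_unbounded q (fun j => j %% q == 0)%N x i) => //.
- move=> k /dvdnP[v ->]; suff -> : diag_mx l ^+ (v * q) *m x = l 0 0 ^+ (v * q) *: x.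
    by rewrite -scalemxAr Cx scaler0.
  rewrite diag_mx_exp mul_diag_mx; apply/colP => j; rewrite !mxE mulnC !exprM.
  by have [->|->] := ord2P j; rewrite ?lq.
- by move=> k; rewrite modnDr.
- by rewrite li prod_one_class.
Qed.

End Unbounded.

Lemma critical_valueE l C (Q Sigma0 : 'M[R[i]]_2) (V : 'M[R[i]]_m)
    (d : R -> measure_display) (T : forall p, measurableType (d p))
    (P : forall p, probability (T p) R)
    (gamma : forall p, nat -> {RV (P p) >-> bool}) (t : R) :
    0 <= t < 1 ->
    (forall p, 0 <= p <= 1 -> t < p ->
       mean_cov_bounded (diag_mx l) C Q V Sigma0 (gamma p)) ->
    (forall p, 0 <= p <= 1 -> p < t ->
       ~ mean_cov_bounded (diag_mx l) C Q V Sigma0 (gamma p)) ->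
  critical_value (diag_mx l) C Q V Sigma0 gamma = t%:E.
Proof.
move=> /andP[t0 t1] hb hu; apply/eqP; rewrite eq_le; apply/andP; split.
  apply/lee_addgt0Pr => e e0.
  (* The infimum is approached from above [t]; if [t + e] leaves the unit interval, [p = 1] is used,
     which exceeds [t]. *)
  have [lt1|le1] := ltP (t + e) 1.
    apply: ereal_inf_lbound; exists (t + e) => //.
    by split; [|apply: hb]; lra.
  apply: (@le_trans _ _ 1%:E); last by rewrite -EFinD lee_fin.
  by apply: ereal_inf_lbound; exists 1 => //; split; [|apply: hb]; lra.
apply: le_ereal_inf_tmp => _ [p [p01 bp] <-]; rewrite lee_fin leNgt.
by apply/negP => pt; exact: (hu p).
Qed.

End CriticalValue.

(** * The critical value *)

Local Close Scope sesquilinear_scope.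

(** Any modulus is allowed here. With [q = n + 1] the contraction factor is [a^2 (a^2 (1 - p))^n],
    which is below 1 for large [n]. *)
Lemma nonresonant_bounded (R : realType) m (l : 'rV[R[i]]_2) (C : 'M[R[i]]_(m, 2))
    (Q Sigma0 : 'M[R[i]]_2) (V : 'M[R[i]]_m) (p a : R) (h : 'rV[R[i]]_m) :
    posdef Q -> posdef V -> posdef Sigma0 -> 0 <= p <= 1 ->
    (forall i, cmod (l 0 i) <= a) ->
    (h *m C) 0 0 != 0 -> (h *m C) 0 1 != 0 ->
    (forall u, (0 < u)%N -> l 0 0 ^+ u != l 0 1 ^+ u) ->
    a ^+ 2 * (1 - p) < 1 ->
  forall i, exists B, forall k, mean_diag (diag_mx l) C Q V Sigma0 p i k <= B.
Proof.
move=> pQ pV pS p01 la h0 h1 lu ap.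
have rho01 : 0 <= a ^+ 2 * (1 - p) < 1.
  by rewrite ap mulr_ge0 ?sqr_ge0 // subr_ge0; case/andP: p01.
have [n n0 hn] := geometric_lt1 (a ^+ 2) rho01.
apply: (@observable_bounded _ _ _ _ _ _ _ _ a pQ pV pS p01 la n.+1 h) => //.
  by move=> [|u]; rewrite ?dvdn0 // => _; exact: lu.
by rewrite mulnS exprD exprM -mulrA -exprMn.
Qed.

(** * Contraction conditions rewritten as thresholds on the arrival rate *)

Section Thresholds.
Variable R : realType.
Implicit Types a p : R.

Lemma threshold_lt a p : 1 <= a -> 1 - a ^- 2 < p -> a ^+ 2 * (1 - p) < 1.
Proof.
move=> a1 ap; rewrite mulrC -ltr_pdivlMr ?exprn_gt0 ?(lt_le_trans ltr01) //.
by rewrite mul1r; lra.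
Qed.

Lemma threshold_gt a p : 1 <= a -> p < 1 - a ^- 2 -> 1 < a ^+ 2 * (1 - p).
Proof.
move=> a1 ap; rewrite mulrC -ltr_pdivrMr ?exprn_gt0 ?(lt_le_trans ltr01) //.
by rewrite mul1r; lra.
Qed.

Lemma threshold_ge0 a : 1 <= a -> 0 <= 1 - a ^- 2 < 1.
Proof.
move=> a1; have a0 : 0 < a ^- 2 by rewrite invr_gt0 exprn_gt0 // (lt_le_trans ltr01).
have : a ^- 2 <= 1 by rewrite invf_le1 ?exprn_ege1 // exprn_gt0 // (lt_le_trans ltr01).
by move=> h; apply/andP; split; lra.
Qed.

(** Since [1 - 1/q = (q - 1)/q], the power of [a] is the [(q - 1)]-th root of [a ^ (-2q)]. *)
Lemma resonant_threshold a q : 1 <= a -> (1 < q)%N ->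
  (a `^ (- (2 / (1 - q%:R^-1)))) ^+ q.-1 * a ^+ (2 * q) = 1.
Proof.
move=> a1 q1; have a0 : 0 < a by exact: lt_le_trans a1.
case: q q1 => [|[|q]] // _; rewrite -powR_mulrn ?powR_ge0 // -powRrM.
have -> : - (2 / (1 - q.+2%:R^-1)) * q.+2.-1%:R = - (2 * q.+2)%:R :> R.
  rewrite natrM -[q.+2.-1]/q.+1 -[q.+2%:R]natr1.
  have y0 : q.+1%:R != 0 :> R by rewrite pnatr_eq0.
  have y1 : q.+1%:R + 1 != 0 :> R by rewrite natr1 pnatr_eq0.
  move: (q.+1%:R) y0 y1 => y y0 y1.
  have -> : 1 - (y + 1)^-1 = y / (y + 1) by field.
  by field; rewrite y0 y1.
by rewrite powR_invn ?ltW // mulVf // expf_neq0 // gt_eqF.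
Qed.

End Thresholds.

Theorem theorem5 (R : realType) (m : nat) (lambda1 lambda2 : R[i])
    (C : 'M[R[i]]_(m, 2)) (Q Sigma0 : 'M[R[i]]_2) (V : 'M[R[i]]_m)
    (d : R -> measure_display) (T : forall p : R, measurableType (d p))
    (P : forall p : R, probability (T p) R)
    (gamma : forall p : R, nat -> {RV (P p) >-> bool}) :
  let A : 'M[R[i]]_2 :=
    diag_mx (\row_(i < 2) if i == 0 then lambda1 else lambda2) in
  let pc : \bar R := critical_value A C Q V Sigma0 gamma in
  cmod lambda2 <= cmod lambda1 ->
  detectable C A ->
  posdef Q -> posdef Sigma0 -> posdef V ->
  (forall p : R, 0 <= p <= 1 -> iid_bernoulli p (gamma p)) ->
  ((cmod lambda2 < cmod lambda1 \/ \rank C = 2%N) ->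
    pc = (if cmod lambda1 < 1 then 0
          else Num.max (1 - cmod lambda1 ^- 2) 0)%:E) /\
  (~ (cmod lambda2 < cmod lambda1 \/ \rank C = 2%N) ->
    forall phi : R, 0 <= phi < 2 * pi -> lambda1 = lambda2 * expj phi ->
    pc = (if cmod lambda1 < 1 then 0
          else Num.max
                 (1 - cmod lambda1 `^ (- (2 / (1 - DM (phi / (2 * pi)))))) 0)%:E).
Proof.
move=> A pc l21 dC pQ pS pV iid.
pose l : 'rV[R[i]]_2 := \row_(i < 2) if i == 0 then lambda1 else lambda2.
rewrite -[A]/(diag_mx l) in dC.
have l0 : l 0 0 = lambda1 by rewrite mxE.
have l1 : l 0 1 = lambda2 by rewrite mxE.
rewrite -l0 -l1 in l21 *; set a := cmod (l 0 0) in l21 *.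
have la i : cmod (l 0 i) <= a by have [->|->] := ord2P i.
have bounded (p : R) (p01 : 0 <= p <= 1) :=
  mean_cov_boundedW (l := l) (C := C) pQ pV pS p01 (iid p p01).
have pcE := @critical_valueE R m l C Q Sigma0 V d T P gamma.
rewrite -[pc]/(critical_value (diag_mx l) C Q V Sigma0 gamma).
have [a1|a1] := ltP a 1.
  have stable : critical_value (diag_mx l) C Q V Sigma0 gamma = 0%:E.
    apply: pcE => [|p p01 _|p /andP[p0 _] pn]; first by rewrite lexx ltr01.
      by apply: (bounded p p01); exact: (stable_bounded C pQ pV pS p01 la a1).
    by move: (lt_le_trans pn p0); rewrite ltxx.
  by split=> // _ phi _ _.
have [j0 Cj0] : exists j, C j 0 != 0 by exact: (detectable_column dC a1).
have lower p (p01 : 0 <= p <= 1) : p < 1 - a ^- 2 ->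
    ~ mean_cov_bounded (diag_mx l) C Q V Sigma0 (gamma p).
  move=> /(threshold_gt a1); exact: (unobserved_unbounded pQ pV pS p01 (iid p p01)).
split=> [hyp|/not_orP[nlt /eqP rC] phi /andP[phi0 _] lphi].
  have t01 := threshold_ge0 a1; rewrite max_l; last by case/andP: t01.
  apply: pcE => // p p01 /(threshold_lt a1) ap; apply: (bounded p p01) => //.
  have [/eqP rC|rC] := boolP (\rank C == 2%N).
    exact: (full_rank_bounded pQ pV pS p01 la rC ap).
  have lt21 : cmod (l 0 1) < a by case: hyp => // /eqP; rewrite (negPf rC).
  (* A stable second mode may be invisible to [C], so the argument with two arrivals is kept for the
     unstable case. *)
  have [l1s|l1u] := ltP (cmod (l 0 1)) 1.
    exact: (triangular_bounded pQ pV pS p01 la Cj0 l1s ap).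
  have [j1 Cj1] : exists j, C j 1 != 0 by exact: (detectable_column dC l1u).
  have [h [h0 h1]] := both_columns_row Cj0 Cj1.
  (* Powers with distinct moduli never coincide, so there is no resonance. *)
  apply: (nonresonant_bounded pQ pV pS p01 la h0 h1) => // u u0.
  apply: contraTneq lt21 => /(congr1 (@cmod R)); rewrite !cmodX -/a => e.
  rewrite -leNgt le_eqVlt; apply/orP; left; apply/eqP.
  exact: (pexpIrn u0 (cmod_ge0 _) (cmod_ge0 _) e).
have e21 : cmod (l 0 1) = a by apply/eqP; rewrite eq_le l21 leNgt; apply/negP.
have [j1 Cj1] : exists j, C j 1 != 0.
  by apply: (detectable_column dC); rewrite e21.
have [h [h0 h1]] := both_columns_row Cj0 Cj1.
have l1n0 : l 0 1 != 0.
  by rewrite -cmod_eq0 e21 gt_eqF // (lt_le_trans ltr01).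
have lexp u : (l 0 0 ^+ u == l 0 1 ^+ u) = (expj phi ^+ u == 1).
  rewrite lphi exprMn -[X in _ == X]mulr1 (inj_eq (mulfI _)) //.
  by rewrite expf_neq0.
have [[-> ord]|[q [q0 -> ord]]] := expj_order phi0.
  rewrite subr0 divr1 powR_invn ?cmod_ge0 //.
  have t01 := threshold_ge0 a1; rewrite max_l; last by case/andP: t01.
  apply: pcE => // p p01 /(threshold_lt a1) ap; apply: (bounded p p01) => //.
  apply: (nonresonant_bounded pQ pV pS p01 la h0 h1) => // u u0.
  by rewrite lexp ord.
(* If [q = 1] the eigenvalues coincide, and a kernel vector of [C] is an unseen eigenvector with
   modulus at least 1, contrary to detectability. *)
have [q1|qn1] := eqVneq q 1%N.
  have /eqP e : l 0 0 ^+ 1 == l 0 1 ^+ 1 by rewrite lexp ord q1.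
  have [x x0 Cx] := rank_lt2_kernel rC.
  suff /(detectable_eigen dC x0 Cx) : diag_mx l *m x = l 0 0 *: x by rewrite ltNge a1.
  rewrite mul_diag_mx; apply/colP => i; rewrite [LHS]mxE [RHS]mxE.
  by congr (_ * _); have [->|->] := ord2P i; last exact: (esym e).
have q_gt1 : (1 < q)%N by rewrite ltn_neqAle eq_sym qn1.
(* [e] is the critical loss probability: [e ^ (q - 1)] balances the growth [a ^ (2q)] exactly, and
   comparing [1 - p] with [e] through this power gives both directions. *)
set e := a `^ _; have e0 : 0 < e by rewrite powR_gt0 // (lt_le_trans ltr01).
have eq1 : e ^+ q.-1 * a ^+ (2 * q) = 1 by exact: resonant_threshold.
have aq1 : 1 <= a ^+ (2 * q) by rewrite exprn_ege1.
have aq0 : 0 < a ^+ (2 * q) by exact: lt_le_trans aq1.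
have qp : (0 < q.-1)%N by rewrite -subn1 subn_gt0.
have e1 : e <= 1.
  have eq0 : 0 <= e ^+ q.-1 by rewrite exprn_ge0 // ltW.
  by rewrite -(expr_le1 qp (ltW e0)) -[leRHS]eq1 ler_peMr.
rewrite max_l ?subr_ge0 //; apply: pcE => [|p p01 pe|p p01 pe].
- by apply/andP; split; lra.
- apply: (bounded p p01).
  apply: (observable_bounded pQ pV pS p01 la q0 h0 h1) => [u qu|].
    by rewrite lexp ord.
  have p1 : 0 <= 1 - p by rewrite subr_ge0; case/andP: p01.
  rewrite -[ltRHS]eq1 mulrC ltr_pM2r // ltr_pXn2r ?nnegrE ?(ltW e0) //.
  by rewrite ltrBlDr addrC -ltrBlDr.
apply: (resonant_unbounded pQ pV pS p01 (iid p p01) q0 rC e21).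
  by apply/eqP; rewrite lexp ord.
have p1 : e < 1 - p by lra.
rewrite -[ltLHS]eq1 mulrC ltr_pM2l // ltr_pXn2r ?nnegrE ?(ltW e0) //.
exact: ltW (lt_trans e0 p1).
Qed.
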